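(* Let $\mathsf{A}$ and $\mathsf{X}$ be topoi and let $L \colon \mathsf{A} \rightleftarrows \mathsf{X} \colon R$ be any adjunction between them, with $L$ left adjoint to $R$. Then the category ${}_L\mathsf{StrCsp}$ of $L$-structured cospans is a topos.
   Context: ''Topos'' means elementary topos. Given a functor $L\colon \mathsf{A}\to\mathsf{X}$, an $L$-structured cospan is a cospan in $\mathsf{X}$ of the form $La \to x \leftarrow Lb$ with $a,b$ objects of $\mathsf{A}$ and $x$ an object of $\mathsf{X}$. The category ${}_L\mathsf{StrCsp}$ has $L$-structured cospans as objects (the objects $a,b$ of $\mathsf A$ being part of the data); an arrow from $La \to x \leftarrow Lb$ to $Lc \to y \leftarrow Ld$ is a triple $(f,g,h)$ with $f\colon a\to c$ and $h\colon b\to d$ in $\mathsf{A}$ and $g\colon x\to y$ in $\mathsf{X}$ such that the two squares formed by $Lf, g$ and by $Lh, g$ with the legs of the cospans commute. Composition is componentwise. *)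

(* Defs.v *)
From Stdlib Require Import List FinFun ProofIrrelevance.

Set Implicit Arguments.
Unset Strict Implicit.
Unset Printing Implicit Defensive.

Declare Scope cat_scope.
Delimit Scope cat_scope with cat.
Local Open Scope cat_scope.

Record category : Type := Category {
  ob :> Type;
  hom : ob -> ob -> Type;
  idm : forall a : ob, hom a a;
  comp : forall a b c : ob, hom b c -> hom a b -> hom a c;
  comp_idl : forall (a b : ob) (f : hom a b), comp (idm b) f = f;
  comp_idr : forall (a b : ob) (f : hom a b), comp f (idm a) = f;
  comp_assoc : forall (a b c d : ob) (h : hom c d) (g : hom b c) (f : hom a b),
    comp h (comp g f) = comp (comp h g) f
}.

Arguments hom {c} a b : rename.
Arguments idm {c} a : rename.
Arguments comp {c a b} {c0} g f : rename.

Notation "g \o f" := (comp g f)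
  (at level 50, left associativity) : cat_scope.

Record functor (C D : category) : Type := Functor {
  fob :> C -> D;
  fmap : forall a b : C, hom a b -> hom (fob a) (fob b);
  fmap_id : forall a : C, fmap (idm a) = idm (fob a);
  fmap_comp : forall (a b c : C) (g : hom b c) (f : hom a b),
    fmap (g \o f) = fmap g \o fmap f
}.

Arguments fmap {C D} F {a b} f : rename.

(** [L] is the left adjoint. *)
Record adjunction (C D : category) (L : functor C D) (R : functor D C) : Type :=
  Adjunction {
    adj_unit : forall a : C, hom a (R (L a));
    adj_counit : forall x : D, hom (L (R x)) x;
    unit_natural : forall (a b : C) (f : hom a b),
      fmap R (fmap L f) \o adj_unit a = adj_unit b \o f;
    counit_natural : forall (x y : D) (g : hom x y),
      g \o adj_counit x = adj_counit y \o fmap L (fmap R g);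
    triangle_left : forall a : C,
      adj_counit (L a) \o fmap L (adj_unit a) = idm (L a);
    triangle_right : forall x : D,
      fmap R (adj_counit x) \o adj_unit (R x) = idm (R x)
  }.

(** [Finite] only asks for a list containing every element, possibly with
    repetitions, so no decidability of equality is involved. *)
Definition finite_category (J : category) : Prop :=
  Finite J /\ forall i j : J, Finite (hom i j).

Record cone (J C : category) (D : functor J C) : Type := Cone {
  apex : C;
  leg : forall j : J, hom apex (D j);
  leg_natural : forall (i j : J) (u : hom i j), fmap D u \o leg i = leg j
}.

Arguments apex {J C D} K : rename.
Arguments leg {J C D} K j : rename.

Definition is_limit (J C : category) (D : functor J C) (K : cone D) : Prop :=
  forall K' : cone D, exists! h : hom (apex K') (apex K),
    forall j : J, leg K j \o h = leg K' j.

Definition has_finite_limits (C : category) : Prop :=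
  forall J : category, finite_category J ->
  forall D : functor J C, exists K : cone D, is_limit K.

Definition is_terminal (C : category) (t : C) : Prop :=
  forall a : C, exists! f : hom a t, True.

Definition is_product (C : category) (a b p : C)
    (p1 : hom p a) (p2 : hom p b) : Prop :=
  forall (z : C) (f : hom z a) (g : hom z b),
  exists! h : hom z p, p1 \o h = f /\ p2 \o h = g.

(** The square
<<
      p --q--> b
      |        |
      p'       g
      v        v
      a --f--> c
>> *)
Definition is_pullback (C : category) (a b c p : C)
    (f : hom a c) (g : hom b c) (p' : hom p a) (q : hom p b) : Prop :=
  f \o p' = g \o q /\
  forall (z : C) (u : hom z a) (v : hom z b), f \o u = g \o v ->
  exists! h : hom z p, p' \o h = u /\ q \o h = v.

(** [e], with the evaluation [ev : e * b -> c], is an exponential [c ^ b].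
    The object [p] with projections [p1], [p2] is a product [e * b]; for any
    product [q] of [z] and [b], the arrow [k : q -> p] is [g * id_b]. *)
Definition is_exponential (C : category) (b c e p : C)
    (p1 : hom p e) (p2 : hom p b) (ev : hom p c) : Prop :=
  is_product p1 p2 /\
  forall (z q : C) (q1 : hom q z) (q2 : hom q b), is_product q1 q2 ->
  forall f : hom q c,
  exists! g : hom z e,
  exists k : hom q p, p1 \o k = g \o q1 /\ p2 \o k = q2 /\ ev \o k = f.

Definition has_exponentials (C : category) : Prop :=
  forall b c : C, exists (e p : C) (p1 : hom p e) (p2 : hom p b) (ev : hom p c),
    is_exponential p1 p2 ev.

Definition monic (C : category) (u x : C) (m : hom u x) : Prop :=
  forall (z : C) (f g : hom z u), m \o f = m \o g -> f = g.

(** In the pullback square defining [chi], the arrow [t : u -> one] is the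
    unique one, [one] being terminal. *)
Definition is_subobject_classifier (C : category) (one omega : C)
    (true_ : hom one omega) : Prop :=
  is_terminal one /\
  forall (u x : C) (m : hom u x), monic m ->
  exists! chi : hom x omega,
  exists t : hom u one, is_pullback chi true_ m t.

Definition has_subobject_classifier (C : category) : Prop :=
  exists (one omega : C) (true_ : hom one omega),
    is_subobject_classifier true_.

Definition is_topos (C : category) : Prop :=
  has_finite_limits C /\ has_exponentials C /\ has_subobject_classifier C.

Section StructuredCospans.

Variables (A X : category) (L : functor A X).

Record strcsp_ob : Type := StrCspOb {
  sc_left : A;
  sc_right : A;
  sc_apex : X;
  sc_legl : hom (L sc_left) sc_apex;
  sc_legr : hom (L sc_right) sc_apex
}.

Record strcsp_hom (S T : strcsp_ob) : Type := StrCspHom {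
  sc_f : hom (sc_left S) (sc_left T);
  sc_g : hom (sc_apex S) (sc_apex T);
  sc_h : hom (sc_right S) (sc_right T);
  sc_comml : sc_g \o sc_legl S = sc_legl T \o fmap L sc_f;
  sc_commr : sc_g \o sc_legr S = sc_legr T \o fmap L sc_h
}.

Lemma strcsp_hom_eq (S T : strcsp_ob) (u v : strcsp_hom S T) :
  sc_f u = sc_f v -> sc_g u = sc_g v -> sc_h u = sc_h v -> u = v.
Proof.
destruct u as [f g h e1 e2], v as [f' g' h' e1' e2']; simpl.
intros <- <- <-.
now rewrite (proof_irrelevance _ e1 e1'), (proof_irrelevance _ e2 e2').
Qed.

Lemma square_id (a : A) (x : X) (l : hom (L a) x) :
  idm x \o l = l \o fmap L (idm a).
Proof. now rewrite fmap_id, comp_idl, comp_idr. Qed.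

Lemma square_comp (a b c : A) (x y z : X)
    (l : hom (L a) x) (m : hom (L b) y) (n : hom (L c) z)
    (f : hom a b) (f' : hom b c) (g : hom x y) (g' : hom y z) :
  g \o l = m \o fmap L f -> g' \o m = n \o fmap L f' ->
  (g' \o g) \o l = n \o fmap L (f' \o f).
Proof.
intros e e'.
now rewrite fmap_comp, <- comp_assoc, e, comp_assoc, e', comp_assoc.
Qed.

Definition strcsp_id (S : strcsp_ob) : strcsp_hom S S :=
  StrCspHom (square_id (sc_legl S)) (square_id (sc_legr S)).

Definition strcsp_comp (S T U : strcsp_ob)
    (v : strcsp_hom T U) (u : strcsp_hom S T) : strcsp_hom S U :=
  StrCspHom (square_comp (sc_comml u) (sc_comml v))
            (square_comp (sc_commr u) (sc_commr v)).

Definition StrCsp : category.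
Proof.
refine (@Category strcsp_ob strcsp_hom strcsp_id strcsp_comp _ _ _);
  intros; apply strcsp_hom_eq; simpl;
  first [apply comp_idl | apply comp_idr | apply comp_assoc].
Defined.

End StructuredCospans.

(* Main.v *)
(** Transposing the legs across the adjunction exhibits a structured cospan as
    a pair of arrows [a -> R x <- b], and [R] preserves limits, so this is
    Artin gluing along [R], done once for each foot.  Limits are computed
    componentwise.  The exponential of [m : c -> R y] by [l : a -> R x] has
    apex [y ^ x], and its foot is the pullback of
    [c ^ a -> (R y) ^ a <- R (y ^ x)].  The subobject classifier has apex
    [Omega_X], and each of its feet is the object of pairs [(w, s)] in
    [Omega_A * R Omega_X] with [w <= tau s], where [tau] classifies the mono
    [R true]: a subobject of [a -> R x] is a subobject of [x] together with a
    subobject of [a] contained in the preimage of its image under [R]. *)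

From Stdlib Require Import List.
Require Import Defs.

Set Implicit Arguments.
Unset Strict Implicit.
Unset Printing Implicit Defensive.

Local Open Scope cat_scope.

(** * Uniqueness and construction rules for universal properties *)

Section UniversalProperties.

Variable C : category.

Lemma terminal_arrow (t a : C) : is_terminal t -> exists f : hom a t, True.
Proof. intros ht. destruct (ht a) as [f _]. now exists f. Qed.

Lemma terminal_eq (t a : C) (f g : hom a t) : is_terminal t -> f = g.
Proof.
intros ht. destruct (ht a) as [h [_ u]].
now rewrite <- (u f I), <- (u g I).
Qed.

Lemma terminal_monic (t x : C) (m : hom t x) : is_terminal t -> monic m.
Proof. intros ht z f g _. exact (terminal_eq f g ht). Qed.

Lemma product_eq (a b p : C) (p1 : hom p a) (p2 : hom p b) :
  is_product p1 p2 -> forall (z : C) (h k : hom z p),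
  p1 \o h = p1 \o k -> p2 \o h = p2 \o k -> h = k.
Proof.
intros hp z h k e1 e2.
destruct (hp z (p1 \o k) (p2 \o k)) as [m [_ u]].
now rewrite <- (u h (conj e1 e2)), <- (u k (conj eq_refl eq_refl)).
Qed.

Lemma product_arrow (a b p : C) (p1 : hom p a) (p2 : hom p b) :
  is_product p1 p2 -> forall (z : C) (f : hom z a) (g : hom z b),
  exists h, p1 \o h = f /\ p2 \o h = g.
Proof. intros hp z f g. destruct (hp z f g) as [h [e _]]. now exists h. Qed.

Lemma product_intro (a b p : C) (p1 : hom p a) (p2 : hom p b) :
  (forall (z : C) (f : hom z a) (g : hom z b),
    exists h, p1 \o h = f /\ p2 \o h = g) ->
  (forall (z : C) (h k : hom z p),
    p1 \o h = p1 \o k -> p2 \o h = p2 \o k -> h = k) ->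
  is_product p1 p2.
Proof.
intros he hu z f g. destruct (he z f g) as [h [<- <-]].
exists h; split; [easy|]. now intros k [e1 e2]; apply hu.
Qed.

Lemma pullback_eq (a b c p : C) (f : hom a c) (g : hom b c)
    (p1 : hom p a) (p2 : hom p b) :
  is_pullback f g p1 p2 -> forall (z : C) (h k : hom z p),
  p1 \o h = p1 \o k -> p2 \o h = p2 \o k -> h = k.
Proof.
intros [sq hp] z h k e1 e2.
assert (e : f \o (p1 \o k) = g \o (p2 \o k)) by now rewrite !comp_assoc, sq.
destruct (hp z _ _ e) as [m [_ u]].
now rewrite <- (u h (conj e1 e2)), <- (u k (conj eq_refl eq_refl)).
Qed.

Lemma pullback_arrow (a b c p : C) (f : hom a c) (g : hom b c)
    (p1 : hom p a) (p2 : hom p b) :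
  is_pullback f g p1 p2 -> forall (z : C) (u : hom z a) (v : hom z b),
  f \o u = g \o v -> exists h, p1 \o h = u /\ p2 \o h = v.
Proof.
intros [_ hp] z u v e. destruct (hp z u v e) as [h [e' _]]. now exists h.
Qed.

Lemma pullback_intro (a b c p : C) (f : hom a c) (g : hom b c)
    (p1 : hom p a) (p2 : hom p b) :
  f \o p1 = g \o p2 ->
  (forall (z : C) (u : hom z a) (v : hom z b), f \o u = g \o v ->
    exists h, p1 \o h = u /\ p2 \o h = v) ->
  (forall (z : C) (h k : hom z p),
    p1 \o h = p1 \o k -> p2 \o h = p2 \o k -> h = k) ->
  is_pullback f g p1 p2.
Proof.
intros sq he hu; split; [exact sq|].
intros z u v e. destruct (he z u v e) as [h [<- <-]].
exists h; split; [easy|]. now intros k [e1 e2]; apply hu.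
Qed.

Lemma pullback_iso (a b c p q : C) (f : hom a c) (g : hom b c)
    (p1 : hom p a) (p2 : hom p b) (q1 : hom q a) (q2 : hom q b)
    (i : hom q p) (j : hom p q) :
  is_pullback f g p1 p2 -> p1 \o i = q1 -> p2 \o i = q2 -> i \o j = idm p ->
  j \o i = idm q -> is_pullback f g q1 q2.
Proof.
intros hp <- <- ij ji.
apply pullback_intro.
- now rewrite !comp_assoc, (proj1 hp).
- intros z u v e. destruct (pullback_arrow hp e) as [h [<- <-]].
  exists (j \o h).
  now rewrite <- !(comp_assoc _ i), (comp_assoc i), ij, comp_idl.
- intros z h k e1 e2.
  assert (e : i \o h = i \o k)
    by (apply (pullback_eq hp); now rewrite !comp_assoc).
  now rewrite <- (comp_idl h), <- (comp_idl k), <- ji, <- !comp_assoc, e.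
Qed.

(** A pair [f], [g] with [m f = m g] is exactly a cone over the cospan [(m, m)]. Monicity thus
    becomes a pullback condition, which for structured cospans can be handled componentwise. *)
Lemma monic_pullback (u x : C) (m : hom u x) :
  monic m <-> is_pullback m m (idm u) (idm u).
Proof.
split.
- intros hm. apply pullback_intro; [easy | |].
  + intros z f g e. exists f. rewrite (hm _ _ _ e). now rewrite comp_idl.
  + intros z h k. now rewrite !comp_idl.
- intros hp z f g e. destruct (pullback_arrow hp e) as [h [<- <-]]. easy.
Qed.

Lemma limit_eq (J : category) (D : functor J C) (K : cone D) :
  is_limit K -> forall (z : C) (h k : hom z (apex K)),
  (forall j : J, leg K j \o h = leg K j \o k) -> h = k.
Proof.
intros hK z h k e.
(* The legs of [K] composed with [k] form a cone, and both [h] and [k] mediate it. *)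
unshelve epose (K' := @Cone J C D z (fun j => leg K j \o k) _).
{ intros i j u. cbn beta. now rewrite comp_assoc, leg_natural. }
destruct (hK K') as [m [_ hm]].
now rewrite <- (hm h e), <- (hm k (fun _ => eq_refl)).
Qed.

End UniversalProperties.

(** * Pullbacks, products and equalizers from finite limits *)

Section FinitelyComplete.

Inductive cospan_ob : Type := cospan_l | cospan_r | cospan_c.

(** The index category [l -> c <- r]. Every hom-set is [unit] or [Empty_set], so parallel arrows are
    equal and the category laws come for free. *)
Definition cospan_hom (i j : cospan_ob) : Type :=
  match i, j with
  | cospan_l, cospan_r | cospan_r, cospan_l
  | cospan_c, cospan_l | cospan_c, cospan_r => Empty_set
  | _, _ => unit
  end.

Lemma cospan_hom_eq (i j : cospan_ob) (f g : cospan_hom i j) : f = g.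
Proof. destruct i, j, f, g; reflexivity. Qed.

Definition cospan_id (i : cospan_ob) : cospan_hom i i :=
  match i with cospan_l | cospan_r | cospan_c => tt end.

Definition cospan_comp (i j k : cospan_ob) :
  cospan_hom j k -> cospan_hom i j -> cospan_hom i k.
Proof.
destruct i, j, k; simpl; intros g f;
  first [exact tt | destruct g; fail | destruct f].
Defined.

Definition cospan_category : category.
Proof.
refine (@Category cospan_ob cospan_hom cospan_id cospan_comp _ _ _);
  intros; apply cospan_hom_eq.
Defined.

Lemma finite_cospan_category : finite_category cospan_category.
Proof.
split.
- exists (cospan_l :: cospan_r :: cospan_c :: nil). intros []; simpl; auto.
- intros [] []; simpl;
    first [now exists nil | exists (tt :: nil); intros []; simpl; auto].
Qed.

Variables (C : category) (hC : has_finite_limits C).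

Definition cospan_fob (a b c : C) (i : cospan_ob) : C :=
  match i with cospan_l => a | cospan_r => b | cospan_c => c end.

Definition cospan_fmap (a b c : C) (f : hom a c) (g : hom b c)
    (i j : cospan_ob) :
  cospan_hom i j -> hom (cospan_fob a b c i) (cospan_fob a b c j) :=
  match i, j return
    cospan_hom i j -> hom (cospan_fob a b c i) (cospan_fob a b c j) with
  | cospan_l, cospan_l => fun _ => idm a
  | cospan_r, cospan_r => fun _ => idm b
  | cospan_c, cospan_c => fun _ => idm c
  | cospan_l, cospan_c => fun _ => f
  | cospan_r, cospan_c => fun _ => g
  | _, _ => fun e : Empty_set => match e with end
  end.

Definition cospan_functor (a b c : C) (f : hom a c) (g : hom b c) :
  functor cospan_category C.
Proof.
refine (@Functor cospan_category C (cospan_fob a b c) (cospan_fmap f g) _ _).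
- now intros [].
- intros [] [] [] v u; simpl in *; try destruct u; try destruct v;
    now rewrite ?comp_idl, ?comp_idr.
Defined.

Definition cospan_cone (a b c z : C) (f : hom a c) (g : hom b c)
    (u : hom z a) (v : hom z b) (e : f \o u = g \o v) :
  cone (cospan_functor f g).
Proof.
refine (@Cone cospan_category C (cospan_functor f g) z
  (fun i => match i with
    | cospan_l => u | cospan_r => v | cospan_c => f \o u end) _).
intros [] [] []; simpl; rewrite ?comp_idl; easy.
Defined.

Lemma pullback_exists (a b c : C) (f : hom a c) (g : hom b c) :
  exists (p : C) (p1 : hom p a) (p2 : hom p b), is_pullback f g p1 p2.
Proof.
destruct (hC finite_cospan_category (cospan_functor f g)) as [K hK].
exists (apex K), (leg K cospan_l), (leg K cospan_r).
pose proof (leg_natural K (i := cospan_l) (j := cospan_c) tt) as el.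
pose proof (leg_natural K (i := cospan_r) (j := cospan_c) tt) as er.
simpl in el, er.
split; [now rewrite el, er|].
intros z u v e.
destruct (hK (cospan_cone e)) as [h [hh hu]]; simpl in h, hh, hu.
exists h; split.
- split; [apply (hh cospan_l) | apply (hh cospan_r)].
- intros k [<- <-]. apply hu. intros []; try easy.
  simpl. now rewrite <- el, <- comp_assoc.
Qed.

Variables (one : C) (hone : is_terminal one).

(** A product is a pullback over the terminal object. *)
Lemma product_exists (a b : C) :
  exists (p : C) (p1 : hom p a) (p2 : hom p b), is_product p1 p2.
Proof.
destruct (terminal_arrow a hone) as [f _].
destruct (terminal_arrow b hone) as [g _].
destruct (pullback_exists f g) as (p & p1 & p2 & hp).
exists p, p1, p2. apply product_intro; [|exact (pullback_eq hp)].
intros z u v. exact (pullback_arrow hp (terminal_eq _ _ hone)).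
Qed.

(** The equalizer is the pullback of the graphs [(id, f)] and [(id, g)] into [a * b]. The first
    coordinates of the graphs are identities, which forces the two projections to coincide. *)
Lemma equalizer_exists (a b : C) (f g : hom a b) :
  exists (e : C) (i : hom e a), f \o i = g \o i /\ monic i /\
  forall (z : C) (u : hom z a), f \o u = g \o u -> exists h, i \o h = u.
Proof.
destruct (product_exists a b) as (p & p1 & p2 & hp).
destruct (product_arrow hp (idm a) f) as [f' [ef1 ef2]].
destruct (product_arrow hp (idm a) g) as [g' [eg1 eg2]].
destruct (pullback_exists f' g') as (e & i & j & he).
assert (ij : i = j).
{ rewrite <- (comp_idl i), <- (comp_idl j), <- ef1 at 1.
  now rewrite <- eg1, <- !comp_assoc, (proj1 he). }
subst j. exists e, i. split; [|split].
- now rewrite <- ef2, <- eg2, <- !comp_assoc, (proj1 he).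
- intros z h k eq. now apply (pullback_eq he).
- intros z u eq.
  destruct (pullback_arrow he (u := u) (v := u)) as [h [eh _]];
    [|now exists h].
  apply (product_eq hp); rewrite !comp_assoc.
  + now rewrite ef1, eg1.
  + now rewrite ef2, eg2.
Qed.

End FinitelyComplete.

(** * Transposition for exponentials *)

Section Exponentials.

Variable C : category.

(** The relation under [exists!] in [is_exponential]: [g] is the transpose of [f], and [k] plays the
    role of [g * id_b]. *)
Definition curries (b c e p : C) (p1 : hom p e) (p2 : hom p b) (ev : hom p c)
    (z q : C) (q1 : hom q z) (q2 : hom q b) (f : hom q c) (g : hom z e) :=
  exists k : hom q p, p1 \o k = g \o q1 /\ p2 \o k = q2 /\ ev \o k = f.

(** Naturality of transposition in [z]; with [h] an identity it changes the product that represents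
    [z * b]. *)
Lemma curries_comp (b c e p : C) (p1 : hom p e) (p2 : hom p b) (ev : hom p c)
    (z q : C) (q1 : hom q z) (q2 : hom q b) (f : hom q c) (g : hom z e)
    (z' q' : C) (q1' : hom q' z') (q2' : hom q' b)
    (h : hom z' z) (k : hom q' q) :
  curries p1 p2 ev q1 q2 f g -> q1 \o k = h \o q1' -> q2 \o k = q2' ->
  curries p1 p2 ev q1' q2' (f \o k) (g \o h).
Proof.
intros (m & e1 & e2 & e3) ek1 ek2. exists (m \o k).
rewrite !comp_assoc, e1, e2, e3, <- comp_assoc, ek1, ek2.
now rewrite comp_assoc.
Qed.

(** The arrow [g * id_b] is determined by its two projections, so [k] is the very arrow that
    witnesses [curries]. *)
Lemma curries_eval (b c e p : C) (p1 : hom p e) (p2 : hom p b) (ev : hom p c)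
    (z q : C) (q1 : hom q z) (q2 : hom q b) (f : hom q c) (g : hom z e)
    (k : hom q p) :
  is_product p1 p2 -> curries p1 p2 ev q1 q2 f g -> p1 \o k = g \o q1 ->
  p2 \o k = q2 -> ev \o k = f.
Proof.
intros hp (k' & e1 & e2 & <-) e1' e2'. f_equal.
apply (product_eq hp); [now rewrite e1, e1' | now rewrite e2, e2'].
Qed.

Lemma exponential_eq (b c e p : C) (p1 : hom p e) (p2 : hom p b) (ev : hom p c)
    (z q : C) (q1 : hom q z) (q2 : hom q b) (f : hom q c) (g g' : hom z e) :
  is_exponential p1 p2 ev -> is_product q1 q2 ->
  curries p1 p2 ev q1 q2 f g -> curries p1 p2 ev q1 q2 f g' -> g = g'.
Proof.
intros [_ he] hq hg hg'. destruct (he _ _ _ _ hq f) as [g0 [_ u]].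
now rewrite <- (u g hg), <- (u g' hg').
Qed.

Lemma exponential_arrow (b c e p : C) (p1 : hom p e) (p2 : hom p b)
    (ev : hom p c) (z q : C) (q1 : hom q z) (q2 : hom q b) (f : hom q c) :
  is_exponential p1 p2 ev -> is_product q1 q2 ->
  exists g, curries p1 p2 ev q1 q2 f g.
Proof.
intros [_ he] hq. destruct (he _ _ _ _ hq f) as [g0 [h _]]. now exists g0.
Qed.

(** [is_exponential] quantifies over all products of [z] and [b]. Any two are isomorphic, so testing
    one product for each [z] is enough. *)
Lemma exponential_intro (b c e p : C) (p1 : hom p e) (p2 : hom p b)
    (ev : hom p c) :
  is_product p1 p2 ->
  (forall z : C, exists (q : C) (q1 : hom q z) (q2 : hom q b),
    is_product q1 q2 /\
    (forall f : hom q c, exists g, curries p1 p2 ev q1 q2 f g) /\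
    (forall (f : hom q c) (g g' : hom z e),
       curries p1 p2 ev q1 q2 f g -> curries p1 p2 ev q1 q2 f g' -> g = g')) ->
  is_exponential p1 p2 ev.
Proof.
intros hp H. split; [exact hp|].
intros z r r1 r2 hr f.
destruct (H z) as (q & q1 & q2 & hq & he & hu).
(* [i] and [j] compare the chosen product [q] with the given [r]; [f] is moved to [q] along [i], and
   the transposition property is moved back along [j]. *)
destruct (product_arrow hr q1 q2) as [i [i1 i2]].
destruct (product_arrow hq r1 r2) as [j [j1 j2]].
assert (ij : i \o j = idm r).
{ apply (product_eq hr); rewrite comp_idr, comp_assoc.
  - now rewrite i1.
  - now rewrite i2. }
assert (iz : r1 \o i = idm z \o q1) by now rewrite comp_idl.
assert (jz : q1 \o j = idm z \o r1) by now rewrite comp_idl.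
destruct (he (f \o i)) as [g hg].
exists g; split.
- pose proof (curries_comp hg jz j2) as hc.
  now rewrite <- comp_assoc, ij, !comp_idr in hc.
- intros g' hg'. apply (hu (f \o i)); [exact hg|].
  rewrite <- (comp_idr g'). exact (curries_comp hg' iz i2).
Qed.

End Exponentials.

(** * Generalised elements of the subobject classifier *)

Section Classifier.

Variables (C : category) (hC : has_finite_limits C).
Variables (one omega : C) (tr : hom one omega).
Hypothesis hO : is_subobject_classifier tr.

(** [w] is read as a truth value at stage [z], in the Kripke-Joyal style. *)
Definition holds (z : C) (w : hom z omega) : Prop :=
  exists t : hom z one, w = tr \o t.

(** The pullback condition on a characteristic arrow, read on generalised elements [h] of [x]. It
    avoids mentioning the arrow to [one], and for monic [m] it is equivalent to the pullback
    square. *)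
Definition classifies (u x : C) (m : hom u x) (w : hom x omega) : Prop :=
  forall (z : C) (h : hom z x), holds (w \o h) <-> exists k, m \o k = h.

Lemma pullback_classifies (u x : C) (m : hom u x) (w : hom x omega)
    (t : hom u one) :
  is_pullback w tr m t -> classifies m w.
Proof.
intros hp z h; split.
- intros [s e]. destruct (pullback_arrow hp e) as [k [ek _]]. now exists k.
- intros [k <-]. exists (t \o k). now rewrite !comp_assoc, (proj1 hp).
Qed.

Lemma classifies_pullback (u x : C) (m : hom u x) (w : hom x omega)
    (t : hom u one) :
  monic m -> classifies m w -> is_pullback w tr m t.
Proof.
intros hm hc. apply pullback_intro.
- destruct (proj2 (hc u m)) as [s ->].
  + exists (idm u). apply comp_idr.
  + now rewrite (terminal_eq s t (proj1 hO)).
- intros z h s e. destruct (proj1 (hc z h)) as [k <-].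
  + now exists s.
  + exists k; split; [easy | apply (terminal_eq _ _ (proj1 hO))].
- intros z h k e _. now apply hm.
Qed.

Lemma classifier_arrow (u x : C) (m : hom u x) :
  monic m -> exists w, classifies m w.
Proof.
intros hm. destruct (proj2 hO _ _ m hm) as [w [[t hp] _]].
exists w. exact (pullback_classifies hp).
Qed.

(** Extensionality: the pullback of [tr] along [w] is a subobject that both arrows classify, so
    uniqueness of the characteristic arrow identifies them. *)
Lemma classifier_eq (x : C) (w w' : hom x omega) :
  (forall (z : C) (h : hom z x), holds (w \o h) <-> holds (w' \o h)) -> w = w'.
Proof.
intros H.
destruct (pullback_exists hC w tr) as (u & m & t & hp).
assert (hm : monic m).
{ intros z h k e. apply (pullback_eq hp); [exact e|].
  apply (terminal_eq _ _ (proj1 hO)). }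
pose proof (pullback_classifies hp) as hc.
assert (hp' : is_pullback w' tr m t).
{ apply classifies_pullback; [exact hm|].
  intros z h. rewrite <- H. apply hc. }
destruct (proj2 hO _ _ m hm) as [w0 [_ hu]].
now rewrite <- (hu w (ex_intro _ t hp)), <- (hu w' (ex_intro _ t hp')).
Qed.

(** [meet] classifies the pair [(tr, tr)] from [one] to [omega * omega], a mono since its domain is
    terminal. *)
Lemma meet_exists :
  exists (o2 : C) (o2l o2r : hom o2 omega) (meet : hom o2 omega),
    is_product o2l o2r /\
    forall (z : C) (h : hom z o2),
      holds (meet \o h) <-> holds (o2l \o h) /\ holds (o2r \o h).
Proof.
destruct (product_exists hC (proj1 hO) omega omega) as (o2 & l & r & hp).
destruct (product_arrow hp tr tr) as [d [dl dr]].
destruct (classifier_arrow (terminal_monic (m := d) (proj1 hO))) as [meet hmeet].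
exists o2, l, r, meet. split; [exact hp|].
intros z h. rewrite (hmeet z h). split.
- intros [k <-]. rewrite !comp_assoc, dl, dr. split; now exists k.
- intros [[s es] [s' es']]. exists s. apply (product_eq hp).
  + now rewrite comp_assoc, dl.
  + rewrite comp_assoc, dr, (terminal_eq s s' (proj1 hO)). easy.
Qed.

(* [O] is the object [{(w, s) | w <= tau s}], cut out of [omega * W] by the
   equation [meet (w, tau s) = w]. *)
Lemma subordinate_pairs (W : C) (tau : hom W omega) :
  exists (O : C) (o1 : hom O omega) (o2 : hom O W),
    (forall (z : C) (h k : hom z O),
       o1 \o h = o1 \o k -> o2 \o h = o2 \o k -> h = k) /\
    (forall (z : C) (h : hom z O),
       holds (o1 \o h) -> holds (tau \o (o2 \o h))) /\
    (forall (z : C) (w : hom z omega) (s : hom z W),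
       (forall (y : C) (h : hom y z),
          holds (w \o h) -> holds (tau \o (s \o h))) ->
       exists k, o1 \o k = w /\ o2 \o k = s).
Proof.
destruct meet_exists as (o2 & ol & or & meet & hp & hmeet).
destruct (product_exists hC (proj1 hO) omega W) as (q & q1 & q2 & hq).
destruct (product_arrow hp q1 (tau \o q2)) as [j [jl jr]].
destruct (equalizer_exists hC (proj1 hO) (meet \o j) q1)
  as (O & i & ei & mi & ui).
exists O, (q1 \o i), (q2 \o i). split; [|split].
- intros z h k e1 e2. apply mi. apply (product_eq hq);
    now rewrite !comp_assoc.
- intros z h. rewrite <- ei, <- !comp_assoc, hmeet, !comp_assoc, jr.
  now intros [_ ?].
- intros z w s H. destruct (product_arrow hq w s) as [k [<- <-]].
  destruct (ui z k) as [k' <-].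
  + apply classifier_eq. intros y h.
    rewrite <- !(comp_assoc meet), hmeet, !comp_assoc, jl, jr.
    split; [now intros []|]. intros hh; split; [exact hh|].
    specialize (H y h hh). now rewrite !comp_assoc in *.
  + exists k'. now rewrite !comp_assoc.
Qed.

End Classifier.

(** * Transposition across the adjunction, and limits preserved by the right adjoint *)

Section RightAdjoint.

Variables (A X : category) (L : functor A X) (R : functor X A).
Variable adj : adjunction L R.

(** [flat] and [sharp] are the two directions of the bijection between [hom (L a) x] and
    [hom a (R x)]. *)
Definition flat (a : A) (x : X) (g : hom (L a) x) : hom a (R x) :=
  fmap R g \o adj_unit adj a.

Definition sharp (a : A) (x : X) (f : hom a (R x)) : hom (L a) x :=
  adj_counit adj x \o fmap L f.

Lemma flat_sharp (a : A) (x : X) (f : hom a (R x)) : flat (sharp f) = f.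
Proof.
unfold flat, sharp. rewrite fmap_comp, <- comp_assoc, unit_natural.
now rewrite comp_assoc, triangle_right, comp_idl.
Qed.

Lemma sharp_flat (a : A) (x : X) (g : hom (L a) x) : sharp (flat g) = g.
Proof.
unfold flat, sharp. rewrite fmap_comp, comp_assoc, <- counit_natural.
now rewrite <- comp_assoc, triangle_left, comp_idr.
Qed.

Lemma flat_comp_l (a : A) (x y : X) (g : hom x y) (l : hom (L a) x) :
  flat (g \o l) = fmap R g \o flat l.
Proof. unfold flat. now rewrite fmap_comp, comp_assoc. Qed.

Lemma flat_comp_r (a b : A) (x : X) (l : hom (L b) x) (f : hom a b) :
  flat (l \o fmap L f) = flat l \o f.
Proof.
unfold flat. now rewrite fmap_comp, <- !comp_assoc, unit_natural.
Qed.

Lemma sharp_comp_l (a : A) (x y : X) (g : hom x y) (l : hom a (R x)) :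
  sharp (fmap R g \o l) = g \o sharp l.
Proof. unfold sharp. now rewrite fmap_comp, !comp_assoc, counit_natural. Qed.

Lemma flat_inj (a : A) (x : X) (g g' : hom (L a) x) : flat g = flat g' -> g = g'.
Proof. intros e. now rewrite <- (sharp_flat g), e, sharp_flat. Qed.

Lemma sharp_inj (a : A) (x : X) (f f' : hom a (R x)) :
  sharp f = sharp f' -> f = f'.
Proof. intros e. now rewrite <- (flat_sharp f), e, flat_sharp. Qed.

(** By naturality of transposition, each square of an arrow of structured cospans becomes a square
    over [R], that is, an arrow of the comma category of [A] over [R]. *)
Lemma square_flat (a b : A) (x y : X) (l : hom (L a) x) (m : hom (L b) y)
    (f : hom a b) (g : hom x y) :
  g \o l = m \o fmap L f <-> fmap R g \o flat l = flat m \o f.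
Proof.
rewrite <- flat_comp_l, <- flat_comp_r. split; [now intros -> | apply flat_inj].
Qed.

Lemma right_adjoint_terminal (t : X) : is_terminal t -> is_terminal (R t).
Proof.
intros ht a. destruct (terminal_arrow (L a) ht) as [g _].
exists (flat g); split; [easy|]. intros f _.
apply sharp_inj. apply (terminal_eq _ _ ht).
Qed.

Lemma right_adjoint_product (x y p : X) (p1 : hom p x) (p2 : hom p y) :
  is_product p1 p2 -> is_product (fmap R p1) (fmap R p2).
Proof.
intros hp. apply product_intro.
- intros z f g. destruct (product_arrow hp (sharp f) (sharp g)) as [h [e1 e2]].
  exists (flat h). now rewrite <- !flat_comp_l, e1, e2, !flat_sharp.
- intros z h k e1 e2. apply sharp_inj, (product_eq hp);
    now rewrite <- !sharp_comp_l, ?e1, ?e2.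
Qed.

Lemma right_adjoint_pullback (x y c p : X) (f : hom x c) (g : hom y c)
    (p1 : hom p x) (p2 : hom p y) :
  is_pullback f g p1 p2 ->
  is_pullback (fmap R f) (fmap R g) (fmap R p1) (fmap R p2).
Proof.
intros hp. apply pullback_intro.
- now rewrite <- !fmap_comp, (proj1 hp).
- intros z u v e. destruct (pullback_arrow hp (u := sharp u) (v := sharp v))
    as [h [e1 e2]].
  + now rewrite <- !sharp_comp_l, e.
  + exists (flat h). now rewrite <- !flat_comp_l, e1, e2, !flat_sharp.
- intros z h k e1 e2. apply sharp_inj, (pullback_eq hp);
    now rewrite <- !sharp_comp_l, ?e1, ?e2.
Qed.

End RightAdjoint.

(** * Exponentials and subobject classifiers at a single foot *)

Section OneSided.

Variables (A X : category) (L : functor A X) (R : functor X A).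
Variable adj : adjunction L R.
Hypothesis hA : is_topos A.

(** An arrow into the pullback [P] is a transpose of some [f : z * a -> c] together with some
    [u : z -> R e]; the equation between [R ev] after [j] and [m] after [f] is what makes the two
    compatible. The object [Q] is [P * a], and [k] is its leg into [R p]. *)
Lemma one_sided_exponential (x y e p : X) (p1 : hom p e) (p2 : hom p x)
    (ev : hom p y) (a c : A) (l : hom a (R x)) (m : hom c (R y)) :
  is_product p1 p2 ->
  exists (P Q : A) (n : hom P (R e)) (q1 : hom Q P) (q2 : hom Q a)
    (k : hom Q (R p)) (ev' : hom Q c),
  is_product q1 q2 /\
  fmap R p1 \o k = n \o q1 /\
  fmap R p2 \o k = l \o q2 /\
  fmap R ev \o k = m \o ev' /\
  (forall (z w : A) (w1 : hom w z) (w2 : hom w a) (u : hom z (R e))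
      (j : hom w (R p)) (f : hom w c),
    is_product w1 w2 ->
    fmap R p1 \o j = u \o w1 -> fmap R p2 \o j = l \o w2 ->
    fmap R ev \o j = m \o f ->
    exists g, n \o g = u /\ curries q1 q2 ev' w1 w2 f g) /\
  (forall (z w : A) (w1 : hom w z) (w2 : hom w a) (f : hom w c)
      (g g' : hom z P),
    is_product w1 w2 -> n \o g = n \o g' ->
    curries q1 q2 ev' w1 w2 f g -> curries q1 q2 ev' w1 w2 f g' -> g = g').
Proof.
intros hp. pose proof (right_adjoint_product adj hp) as hRp.
destruct hA as [limA [expA (one & omega & tr & hone & _)]].
destruct (expA a c) as (C0 & pc & pc1 & pc2 & evc & hc).
destruct (expA a (R y)) as (D0 & pd & pd1 & pd2 & evd & hd).
destruct (product_exists limA hone (R e) a) as (r & r1 & r2 & hr).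
(* [j0] is [id * l : R e * a -> R e * R x], with [R p] serving as the latter product. *)
destruct (product_arrow hRp r1 (l \o r2)) as [j0 [j01 j02]].
(* [alpha : c ^ a -> (R y) ^ a] is composition with [m]; [beta : R e -> (R y) ^ a] transposes [R ev]
   after [j0]. *)
destruct (exponential_arrow (m \o evc) hd (proj1 hc)) as [alpha halpha].
destruct (exponential_arrow (fmap R ev \o j0) hd hr) as [beta hbeta].
destruct (pullback_exists limA alpha beta) as (P & pi & n & hP).
destruct (product_exists limA hone P a) as (Q & q1 & q2 & hQ).
destruct (product_arrow (proj1 hc) (pi \o q1) q2) as [kc [kc1 kc2]].
destruct (product_arrow hr (n \o q1) q2) as [kr [kr1 kr2]].
exists P, Q, n, q1, q2, (j0 \o kr), (evc \o kc).
split; [exact hQ|]. split; [now rewrite comp_assoc, j01|].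
split; [now rewrite comp_assoc, j02, <- comp_assoc, kr2|].
split; [|split].
(* Since [alpha pi = beta n] on [P], evaluating either side gives the same arrow [Q -> R y]. *)
- destruct (curries_comp halpha kc1 kc2) as (k & k1 & k2 & k3).
  destruct (curries_comp hbeta kr1 kr2) as (k' & k1' & k2' & k3').
  assert (kk : k = k').
  { apply (product_eq (proj1 hd)); [|now rewrite k2, k2'].
    now rewrite k1, k1', (proj1 hP). }
  now rewrite !comp_assoc, <- k3, kk, k3'.
- intros z w w1 w2 u j f hw ej1 ej2 ejv.
  destruct (exponential_arrow f hc hw) as [gam hgam].
  destruct (product_arrow hr (u \o w1) w2) as [ku [ku1 ku2]].
  assert (ej : j = j0 \o ku).
  { apply (product_eq hRp); rewrite comp_assoc.
    - now rewrite j01, ku1.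
    - now rewrite j02, <- comp_assoc, ku2. }
  destruct (pullback_arrow hP (u := gam) (v := u)) as [g [g1 g2]].
  (* [alpha gam] and [beta u] are both transposes of [m f]. *)
  { apply (exponential_eq (f := m \o f) hd hw).
    - destruct hgam as (kg & kg1 & kg2 & <-).
      rewrite comp_assoc. exact (curries_comp halpha kg1 kg2).
    - rewrite <- ejv, ej, comp_assoc. exact (curries_comp hbeta ku1 ku2). }
  exists g. split; [exact g2|].
  destruct (product_arrow hQ (g \o w1) w2) as [k [k1 k2]].
  exists k. split; [exact k1|]. split; [exact k2|].
  destruct hgam as (kg & kg1 & kg2 & <-).
  rewrite <- comp_assoc. f_equal. apply (product_eq (proj1 hc)).
  + now rewrite comp_assoc, kc1, kg1, <- comp_assoc, k1, comp_assoc, g1.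
  + now rewrite comp_assoc, kc2, kg2, k2.
- intros z w w1 w2 f g g' hw en hg hg'.
  apply (pullback_eq hP); [|exact en].
  (* The component of such an arrow in [c ^ a] is a transpose of [f], hence unique. *)
  assert (H : forall h : hom z P, curries q1 q2 (evc \o kc) w1 w2 f h ->
    curries pc1 pc2 evc w1 w2 f (pi \o h)).
  { intros h (k & k1 & k2 & <-). exists (kc \o k).
    rewrite !comp_assoc, kc1, kc2. split; [|easy].
    now rewrite <- !comp_assoc, k1. }
  exact (exponential_eq hc hw (H g hg) (H g' hg')).
Qed.

(** An arrow [a -> O] amounts to an arrow [s : a -> R omegaX] and a subobject of [a] lying in the
    part that [s] sends into [R trX]. The first coordinate of [O] recovers the subobject and the
    second coordinate is [n]; both the existence and the uniqueness of [phi] rest on this. *)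
Lemma one_sided_classifier (oneA : A) (oneX omegaX : X) (trX : hom oneX omegaX) :
  is_terminal oneA -> is_subobject_classifier trX ->
  exists (O : A) (n : hom O (R omegaX)) (tr : hom oneA O),
  (forall t : hom oneA (R oneX), n \o tr = fmap R trX \o t) /\
  (forall (v x : X) (g : hom v x) (chi : hom x omegaX) (s : hom v oneX)
      (a u : A) (l : hom a (R x)) (m : hom u (R v)) (f : hom u a),
    is_pullback chi trX g s -> monic f -> fmap R g \o m = l \o f ->
    exists phi : hom a O, n \o phi = fmap R chi \o l /\
      forall t : hom u oneA, is_pullback phi tr f t) /\
  (forall (a u : A) (f : hom u a) (t t' : hom u oneA) (phi phi' : hom a O),
    n \o phi = n \o phi' -> is_pullback phi tr f t ->
    is_pullback phi' tr f t' -> phi = phi').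
Proof.
intros h1 hX.
destruct hA as [limA [_ (one & omega & tr & hO)]].
pose proof (right_adjoint_terminal adj (proj1 hX)) as hR1.
destruct (classifier_arrow hO (terminal_monic (m := fmap R trX) hR1))
  as [tau htau].
destruct (subordinate_pairs limA hO tau) as (O & o1 & o2 & Omon & Ole & Oex).
(* The truth arrow of [O] is the pair [(tr, R trX)], moved to the given terminal object [oneA] by
   [i] and [r]. *)
destruct (terminal_arrow oneA (proj1 hO)) as [i _].
destruct (terminal_arrow oneA hR1) as [r _].
destruct (Oex oneA (tr \o i) (fmap R trX \o r)) as [true' [et1 et2]].
{ intros y h _. apply htau. exists (r \o h). apply comp_assoc. }
(* In [O] a true first coordinate forces the second into [R trX], so truth is decided by the first
   coordinate alone. *)
assert (holds_true : forall (z : A) (h : hom z O),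
  holds tr (o1 \o h) <-> exists t, h = true' \o t).
{ intros z h. split.
  - intros hh. destruct (terminal_arrow z h1) as [t _]. exists t.
    pose proof (Ole z h hh) as hs. apply htau in hs. destruct hs as [k ek].
    apply Omon; rewrite comp_assoc.
    + destruct hh as [q ->]. rewrite et1, <- comp_assoc. f_equal.
      apply (terminal_eq _ _ (proj1 hO)).
    + rewrite <- ek, et2, <- comp_assoc. f_equal.
      apply (terminal_eq _ _ hR1).
  - intros [t ->]. exists (i \o t). now rewrite comp_assoc, et1, comp_assoc. }
(* Hence pulling [true'] back along [phi] gives the subobject classified by the first coordinate of
   [phi]. *)
assert (pull_true : forall (a u : A) (f : hom u a) (phi : hom a O)
    (t : hom u oneA), is_pullback phi true' f t -> classifies tr f (o1 \o phi)).
{ intros a u f phi t hp z h. rewrite <- comp_assoc, holds_true. split.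
  - intros [s es]. destruct (pullback_arrow hp es) as [k [ek _]]. now exists k.
  - intros [k <-]. exists (t \o k). now rewrite !comp_assoc, (proj1 hp). }
exists O, o2, true'. split; [|split].
- intros t. rewrite et2. f_equal. apply (terminal_eq _ _ hR1).
- intros v x g chi s a u l m f hp hf sq.
  pose proof (right_adjoint_pullback adj hp) as hRp.
  destruct (classifier_arrow hO hf) as [w hw].
  destruct (Oex a w (fmap R chi \o l)) as [phi [e1 e2]].
  (* An element of [a] at which [w] holds comes from [u]. By the square [sq], its image in [R x]
     comes from [R v], and [R chi] sends that into [R trX]. *)
  { intros y h hh. apply htau. apply hw in hh. destruct hh as [k <-].
    exists (fmap R s \o (m \o k)).
    rewrite <- !comp_assoc, (comp_assoc l), <- sq, !comp_assoc.
    now rewrite (proj1 hRp). }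
  exists phi. split; [exact e2|]. intros t.
  apply pullback_intro.
  + destruct (proj1 (holds_true u (phi \o f))) as [t' et'].
    * rewrite comp_assoc, e1. apply hw. exists (idm u). apply comp_idr.
    * rewrite et'. f_equal. apply (terminal_eq _ _ h1).
  + intros z h q e. destruct (proj1 (hw z h)) as [k <-].
    * rewrite <- e1, <- comp_assoc. apply holds_true. now exists q.
    * exists k. split; [easy | apply (terminal_eq _ _ h1)].
  + intros z h k e _. now apply hf.
- intros a u f t t' phi phi' en hp hp'. apply Omon; [|exact en].
  apply (classifier_eq limA hO). intros z h.
  now rewrite (pull_true _ _ _ _ _ hp z h), (pull_true _ _ _ _ _ hp' z h).
Qed.

(** The exponential at one foot with its legs transposed into [X], in the shape of half a structured
    cospan. The apex data [e], [p], [ev] come from outside, so that two feet can share them. *)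
Lemma comma_exponential (x y e p : X) (p1 : hom p e) (p2 : hom p x)
    (ev : hom p y) (a c : A) (l : hom (L a) x) (m : hom (L c) y) :
  is_product p1 p2 ->
  exists (P Q : A) (n : hom (L P) e) (q1 : hom Q P) (q2 : hom Q a)
    (k : hom (L Q) p) (ev' : hom Q c),
  is_product q1 q2 /\
  p1 \o k = n \o fmap L q1 /\
  p2 \o k = l \o fmap L q2 /\
  ev \o k = m \o fmap L ev' /\
  (forall (z w : A) (w1 : hom w z) (w2 : hom w a) (zx wx : X)
      (lz : hom (L z) zx) (lw : hom (L w) wx) (w1x : hom wx zx)
      (w2x : hom wx x) (f : hom w c) (fx : hom wx y) (gx : hom zx e),
    is_product w1 w2 ->
    w1x \o lw = lz \o fmap L w1 -> w2x \o lw = l \o fmap L w2 ->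
    fx \o lw = m \o fmap L f -> curries p1 p2 ev w1x w2x fx gx ->
    exists g, gx \o lz = n \o fmap L g /\ curries q1 q2 ev' w1 w2 f g) /\
  (forall (z w : A) (w1 : hom w z) (w2 : hom w a) (zx : X)
      (lz : hom (L z) zx) (gx : hom zx e) (f : hom w c) (g g' : hom z P),
    is_product w1 w2 ->
    gx \o lz = n \o fmap L g -> gx \o lz = n \o fmap L g' ->
    curries q1 q2 ev' w1 w2 f g -> curries q1 q2 ev' w1 w2 f g' -> g = g').
Proof.
intros hp.
destruct (one_sided_exponential ev (flat adj l) (flat adj m) hp)
  as (P & Q & n & q1 & q2 & k & ev' & hQ & e1 & e2 & e3 & hex & huq).
exists P, Q, (sharp adj n), q1, q2, (sharp adj k), ev'.
rewrite !(square_flat adj), !flat_sharp.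
do 4 (split; [easy|]). split.
- intros z w w1 w2 zx wx lz lw w1x w2x f fx gx hw s1 s2 s3 (kx & k1 & k2 & k3).
  rewrite (square_flat adj) in s1, s2, s3.
  (* The arrows [u] and [j] needed in [A] are the transposed legs followed by [R] of the apex arrows
     [gx] and [kx]. *)
  destruct (hex z w w1 w2 (fmap R gx \o flat adj lz) (fmap R kx \o flat adj lw) f)
    as [g [eg hg]]; [exact hw | | | |].
  + now rewrite comp_assoc, <- fmap_comp, k1, fmap_comp, <- !comp_assoc, s1.
  + now rewrite comp_assoc, <- fmap_comp, k2.
  + now rewrite comp_assoc, <- fmap_comp, k3.
  + exists g. now rewrite (square_flat adj), flat_sharp.
- intros z w w1 w2 zx lz gx f g g' hw.
  rewrite !(square_flat adj), !flat_sharp. intros eg eg'.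
  apply (huq z w w1 w2 f g g' hw). now rewrite <- eg.
Qed.

(** The characteristic arrow [chi] of the apex is given, so that both feet can be classified over
    the same one. *)
Lemma comma_classifier (oneA : A) (oneX omegaX : X) (trX : hom oneX omegaX) :
  is_terminal oneA -> is_subobject_classifier trX ->
  exists (O : A) (n : hom (L O) omegaX) (tr : hom oneA O),
  (forall t : hom (L oneA) oneX, trX \o t = n \o fmap L tr) /\
  (forall (v x : X) (g : hom v x) (chi : hom x omegaX) (s : hom v oneX)
      (a u : A) (l : hom (L a) x) (m : hom (L u) v) (f : hom u a),
    is_pullback chi trX g s -> monic f -> g \o m = l \o fmap L f ->
    exists phi : hom a O, chi \o l = n \o fmap L phi /\
      forall t : hom u oneA, is_pullback phi tr f t) /\
  (forall (a u : A) (x : X) (l : hom (L a) x) (chi : hom x omegaX)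
      (f : hom u a) (t t' : hom u oneA) (phi phi' : hom a O),
    chi \o l = n \o fmap L phi -> chi \o l = n \o fmap L phi' ->
    is_pullback phi tr f t -> is_pullback phi' tr f t' -> phi = phi').
Proof.
intros h1 hX.
destruct (one_sided_classifier h1 hX) as (O & n & tr & etr & hex & huq).
exists O, (sharp adj n), tr. split; [|split].
- intros t. now rewrite (square_flat adj), flat_sharp.
- intros v x g chi s a u l m f hp hf. rewrite (square_flat adj). intros sq.
  destruct (hex v x g chi s a u _ _ f hp hf sq) as [phi [e hphi]].
  exists phi. now rewrite (square_flat adj), flat_sharp.
- intros a u x l chi f t t' phi phi'.
  rewrite !(square_flat adj), !flat_sharp. intros e e'.
  apply huq. now rewrite <- e.
Qed.

End OneSided.

(** * Limits of structured cospans *)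

Section Componentwise.

Variables (A X : category) (L : functor A X).

(** The leg condition of a mediating arrow is tested after each projection [pg] out of the limit
    apex; this is the equation to be checked there. *)
Lemma square_factor (a b c : A) (x y z : X) (l : hom (L a) x) (m : hom (L b) y)
    (n : hom (L c) z) (pf : hom b c) (pg : hom y z) (hf : hom a b)
    (hg : hom x y) (f : hom a c) (g : hom x z) :
  pg \o m = n \o fmap L pf -> g \o l = n \o fmap L f ->
  pf \o hf = f -> pg \o hg = g ->
  pg \o (hg \o l) = pg \o (m \o fmap L hf).
Proof.
intros sp sq <- <-.
rewrite !comp_assoc, sq, sp, fmap_comp. apply comp_assoc.
Qed.

Lemma strcsp_terminal (oneA : A) (oneX : X) (l r : hom (L oneA) oneX) :
  is_terminal oneA -> is_terminal oneX ->
  is_terminal (StrCspOb l r : StrCsp L).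
Proof.
intros hA hX S.
destruct (terminal_arrow (sc_left S) hA) as [f _].
destruct (terminal_arrow (sc_right S) hA) as [h _].
destruct (terminal_arrow (sc_apex S) hX) as [g _].
unshelve eexists (@StrCspHom _ _ L S (StrCspOb l r) f g h _ _);
  try apply (terminal_eq _ _ hX).
split; [easy|]. intros u _. apply strcsp_hom_eq; simpl;
  first [apply (terminal_eq _ _ hA) | apply (terminal_eq _ _ hX)].
Qed.

Lemma strcsp_product (S T U : StrCsp L) (p : hom U S) (q : hom U T) :
  is_product (sc_f p) (sc_f q) -> is_product (sc_g p) (sc_g q) ->
  is_product (sc_h p) (sc_h q) -> is_product p q.
Proof.
intros hf hg hh. apply product_intro.
- intros Z F G.
  destruct (product_arrow hf (sc_f F) (sc_f G)) as [f [f1 f2]].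
  destruct (product_arrow hg (sc_g F) (sc_g G)) as [g [g1 g2]].
  destruct (product_arrow hh (sc_h F) (sc_h G)) as [h [h1 h2]].
  unshelve eexists (@StrCspHom _ _ L Z U f g h _ _).
  + apply (product_eq hg).
    * exact (square_factor (sc_comml p) (sc_comml F) f1 g1).
    * exact (square_factor (sc_comml q) (sc_comml G) f2 g2).
  + apply (product_eq hg).
    * exact (square_factor (sc_commr p) (sc_commr F) h1 g1).
    * exact (square_factor (sc_commr q) (sc_commr G) h2 g2).
  + split; now apply strcsp_hom_eq.
- intros Z F G e1 e2. apply strcsp_hom_eq.
  + apply (product_eq hf); [exact (f_equal (@sc_f _ _ _ _ _) e1)
      | exact (f_equal (@sc_f _ _ _ _ _) e2)].
  + apply (product_eq hg); [exact (f_equal (@sc_g _ _ _ _ _) e1)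
      | exact (f_equal (@sc_g _ _ _ _ _) e2)].
  + apply (product_eq hh); [exact (f_equal (@sc_h _ _ _ _ _) e1)
      | exact (f_equal (@sc_h _ _ _ _ _) e2)].
Qed.

Lemma strcsp_pullback (S T V U : StrCsp L) (F : hom S V) (G : hom T V)
    (p : hom U S) (q : hom U T) :
  is_pullback (sc_f F) (sc_f G) (sc_f p) (sc_f q) ->
  is_pullback (sc_g F) (sc_g G) (sc_g p) (sc_g q) ->
  is_pullback (sc_h F) (sc_h G) (sc_h p) (sc_h q) -> is_pullback F G p q.
Proof.
intros hf hg hh. apply pullback_intro.
- apply strcsp_hom_eq; [exact (proj1 hf) | exact (proj1 hg) | exact (proj1 hh)].
- intros Z M N e.
  destruct (pullback_arrow hf (f_equal (@sc_f _ _ _ _ _) e)) as [f [f1 f2]].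
  destruct (pullback_arrow hg (f_equal (@sc_g _ _ _ _ _) e)) as [g [g1 g2]].
  destruct (pullback_arrow hh (f_equal (@sc_h _ _ _ _ _) e)) as [h [h1 h2]].
  unshelve eexists (@StrCspHom _ _ L Z U f g h _ _).
  + apply (pullback_eq hg).
    * exact (square_factor (sc_comml p) (sc_comml M) f1 g1).
    * exact (square_factor (sc_comml q) (sc_comml N) f2 g2).
  + apply (pullback_eq hg).
    * exact (square_factor (sc_commr p) (sc_commr M) h1 g1).
    * exact (square_factor (sc_commr q) (sc_commr N) h2 g2).
  + split; now apply strcsp_hom_eq.
- intros Z M N e1 e2. apply strcsp_hom_eq.
  + apply (pullback_eq hf); [exact (f_equal (@sc_f _ _ _ _ _) e1)
      | exact (f_equal (@sc_f _ _ _ _ _) e2)].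
  + apply (pullback_eq hg); [exact (f_equal (@sc_g _ _ _ _ _) e1)
      | exact (f_equal (@sc_g _ _ _ _ _) e2)].
  + apply (pullback_eq hh); [exact (f_equal (@sc_h _ _ _ _ _) e1)
      | exact (f_equal (@sc_h _ _ _ _ _) e2)].
Qed.

Hypotheses (limA : has_finite_limits A) (limX : has_finite_limits X).

(** The three component products are returned instead of [is_product], because the exponential is
    later tested on each component separately. *)
Lemma strcsp_product_exists (oneA : A) (oneX : X) (S T : StrCsp L) :
  is_terminal oneA -> is_terminal oneX ->
  exists (U : StrCsp L) (p : hom U S) (q : hom U T),
    is_product (sc_f p) (sc_f q) /\ is_product (sc_g p) (sc_g q) /\
    is_product (sc_h p) (sc_h q).
Proof.
intros hA hX.
destruct (product_exists limA hA (sc_left S) (sc_left T))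
  as (a & a1 & a2 & ha).
destruct (product_exists limA hA (sc_right S) (sc_right T))
  as (b & b1 & b2 & hb).
destruct (product_exists limX hX (sc_apex S) (sc_apex T))
  as (x & x1 & x2 & hx).
destruct (product_arrow hx (sc_legl S \o fmap L a1) (sc_legl T \o fmap L a2))
  as [l [l1 l2]].
destruct (product_arrow hx (sc_legr S \o fmap L b1) (sc_legr T \o fmap L b2))
  as [r [r1 r2]].
now exists (StrCspOb l r), (@StrCspHom _ _ L (StrCspOb l r) S a1 x1 b1 l1 r1),
  (@StrCspHom _ _ L (StrCspOb l r) T a2 x2 b2 l2 r2).
Qed.

(** Shows that a cone over the feet, sent through [L] and followed by the legs, is a cone over the
    apex diagram. *)
Lemma square_leg (a b d : A) (x y : X) (l : hom (L a) x) (m : hom (L b) y)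
    (f : hom a b) (g : hom x y) (p : hom d a) (q : hom d b) :
  g \o l = m \o fmap L f -> f \o p = q ->
  g \o (l \o fmap L p) = m \o fmap L q.
Proof. intros sq <-. now rewrite comp_assoc, sq, fmap_comp, comp_assoc. Qed.

(** The pullback built componentwise is isomorphic to the given one, and the components of an
    isomorphism are isomorphisms. *)
Lemma strcsp_pullback_components (S T V U : StrCsp L) (F : hom S V)
    (G : hom T V) (p : hom U S) (q : hom U T) :
  is_pullback F G p q ->
  is_pullback (sc_f F) (sc_f G) (sc_f p) (sc_f q) /\
  is_pullback (sc_g F) (sc_g G) (sc_g p) (sc_g q) /\
  is_pullback (sc_h F) (sc_h G) (sc_h p) (sc_h q).
Proof.
intros hp.
destruct (pullback_exists limA (sc_f F) (sc_f G)) as (a & a1 & a2 & ha).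
destruct (pullback_exists limA (sc_h F) (sc_h G)) as (b & b1 & b2 & hb).
destruct (pullback_exists limX (sc_g F) (sc_g G)) as (x & x1 & x2 & hx).
destruct (pullback_arrow hx
  (eq_trans (square_leg (sc_comml F) (proj1 ha))
    (eq_sym (square_leg (sc_comml G) eq_refl)))) as [l [l1 l2]].
destruct (pullback_arrow hx
  (eq_trans (square_leg (sc_commr F) (proj1 hb))
    (eq_sym (square_leg (sc_commr G) eq_refl)))) as [r [r1 r2]].
set (W := StrCspOb l r : StrCsp L).
set (P := @StrCspHom _ _ L W S a1 x1 b1 l1 r1 : hom W S).
set (Q := @StrCspHom _ _ L W T a2 x2 b2 l2 r2 : hom W T).
assert (hP : is_pullback F G P Q) by now apply strcsp_pullback.
destruct (pullback_arrow hP (proj1 hp)) as [i [i1 i2]].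
destruct (pullback_arrow hp (proj1 hP)) as [j [j1 j2]].
assert (ij : i \o j = idm W).
{ apply (pullback_eq hP); rewrite comp_assoc, comp_idr.
  - now rewrite i1.
  - now rewrite i2. }
assert (ji : j \o i = idm U).
{ apply (pullback_eq hp); rewrite comp_assoc, comp_idr.
  - now rewrite j1.
  - now rewrite j2. }
split; [|split].
- apply (pullback_iso (i := sc_f i) (j := sc_f j) ha).
  + exact (f_equal (@sc_f _ _ _ _ _) i1).
  + exact (f_equal (@sc_f _ _ _ _ _) i2).
  + exact (f_equal (@sc_f _ _ _ _ _) ij).
  + exact (f_equal (@sc_f _ _ _ _ _) ji).
- apply (pullback_iso (i := sc_g i) (j := sc_g j) hx).
  + exact (f_equal (@sc_g _ _ _ _ _) i1).
  + exact (f_equal (@sc_g _ _ _ _ _) i2).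
  + exact (f_equal (@sc_g _ _ _ _ _) ij).
  + exact (f_equal (@sc_g _ _ _ _ _) ji).
- apply (pullback_iso (i := sc_h i) (j := sc_h j) hb).
  + exact (f_equal (@sc_h _ _ _ _ _) i1).
  + exact (f_equal (@sc_h _ _ _ _ _) i2).
  + exact (f_equal (@sc_h _ _ _ _ _) ij).
  + exact (f_equal (@sc_h _ _ _ _ _) ji).
Qed.

Lemma strcsp_monic_components (S T : StrCsp L) (m : hom S T) :
  monic m -> monic (sc_f m) /\ monic (sc_g m) /\ monic (sc_h m).
Proof.
intros hm. apply monic_pullback, strcsp_pullback_components in hm.
now rewrite !monic_pullback.
Qed.

Lemma strcsp_finite_limits : has_finite_limits (StrCsp L).
Proof.
intros J hJ D.
pose (Df := @Functor J A (fun j => sc_left (D j)) (fun i j u => sc_f (fmap D u))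
  (fun i => f_equal (@sc_f _ _ _ _ _) (fmap_id D i))
  (fun i j k v u => f_equal (@sc_f _ _ _ _ _) (fmap_comp D v u))).
pose (Dg := @Functor J X (fun j => sc_apex (D j)) (fun i j u => sc_g (fmap D u))
  (fun i => f_equal (@sc_g _ _ _ _ _) (fmap_id D i))
  (fun i j k v u => f_equal (@sc_g _ _ _ _ _) (fmap_comp D v u))).
pose (Dh := @Functor J A (fun j => sc_right (D j)) (fun i j u => sc_h (fmap D u))
  (fun i => f_equal (@sc_h _ _ _ _ _) (fmap_id D i))
  (fun i j k v u => f_equal (@sc_h _ _ _ _ _) (fmap_comp D v u))).
destruct (limA hJ Df) as [Kf hf].
destruct (limX hJ Dg) as [Kg hg].
destruct (limA hJ Dh) as [Kh hh].
(* [L] of the limit of the feet, with the legs of [D], is a cone over [Dg]; its mediating arrow into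
   the apex limit is the new leg. *)
unshelve epose (Kl := @Cone J X Dg (L (apex Kf))
  (fun j => sc_legl (D j) \o fmap L (leg Kf j)) _).
{ intros i j u.
  exact (square_leg (sc_comml (fmap D u)) (leg_natural Kf u)). }
unshelve epose (Kr := @Cone J X Dg (L (apex Kh))
  (fun j => sc_legr (D j) \o fmap L (leg Kh j)) _).
{ intros i j u.
  exact (square_leg (sc_commr (fmap D u)) (leg_natural Kh u)). }
destruct (hg Kl) as [l [el _]]. destruct (hg Kr) as [r [er _]].
simpl in l, el, r, er.
pose (V := StrCspOb l r : StrCsp L).
unshelve epose (K := @Cone J (StrCsp L) D V
  (fun j => @StrCspHom _ _ L V (D j) (leg Kf j) (leg Kg j) (leg Kh j)
    (el j) (er j)) _).
{ intros i j u. apply strcsp_hom_eq; simpl.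
  - exact (leg_natural Kf u).
  - exact (leg_natural Kg u).
  - exact (leg_natural Kh u). }
exists K. intros K'.
pose (Cf := @Cone J A Df (sc_left (apex K')) (fun j => sc_f (leg K' j))
  (fun i j u => f_equal (@sc_f _ _ _ _ _) (leg_natural K' u))).
pose (Cg := @Cone J X Dg (sc_apex (apex K')) (fun j => sc_g (leg K' j))
  (fun i j u => f_equal (@sc_g _ _ _ _ _) (leg_natural K' u))).
pose (Ch := @Cone J A Dh (sc_right (apex K')) (fun j => sc_h (leg K' j))
  (fun i j u => f_equal (@sc_h _ _ _ _ _) (leg_natural K' u))).
destruct (hf Cf) as [f [ef uf]].
destruct (hg Cg) as [g [eg ug]].
destruct (hh Ch) as [h [eh uh]].
unshelve eexists (@StrCspHom _ _ L (apex K') V f g h _ _).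
- apply (limit_eq hg). intros j.
  exact (square_factor (el j) (sc_comml (leg K' j)) (ef j) (eg j)).
- apply (limit_eq hg). intros j.
  exact (square_factor (er j) (sc_commr (leg K' j)) (eh j) (eg j)).
- split.
  + intros j. apply strcsp_hom_eq; [exact (ef j) | exact (eg j) | exact (eh j)].
  + intros m em. apply strcsp_hom_eq; simpl.
    * apply uf. intros j. exact (f_equal (@sc_f _ _ _ _ _) (em j)).
    * apply ug. intros j. exact (f_equal (@sc_g _ _ _ _ _) (em j)).
    * apply uh. intros j. exact (f_equal (@sc_h _ _ _ _ _) (em j)).
Qed.

End Componentwise.

(** * Exponentials and the subobject classifier of structured cospans *)

Section StructuredCospanTopos.

Variables (A X : category) (L : functor A X) (R : functor X A).
Variable adj : adjunction L R.
Hypotheses (hA : is_topos A) (hX : is_topos X).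

Lemma strcsp_exponentials : has_exponentials (StrCsp L).
Proof.
pose proof hA as [limA [_ (oneA & omA & trA & h1A & _)]].
pose proof hX as [limX [expX (oneX & omX & trX & h1X & _)]].
intros S T.
destruct (expX (sc_apex S) (sc_apex T)) as (e & p & p1 & p2 & ev & he).
pose proof (proj1 he) as hp.
(* Both feet are built over the same exponential [e] of the apices. *)
destruct (comma_exponential adj hA ev (sc_legl S) (sc_legl T) hp)
  as (Pl & Ql & nl & ql1 & ql2 & kl & evl & hql & el1 & el2 & el3 & xl & ul).
destruct (comma_exponential adj hA ev (sc_legr S) (sc_legr T) hp)
  as (Pr & Qr & nr & qr1 & qr2 & kr & evr & hqr & er1 & er2 & er3 & xr & ur).
set (E := StrCspOb nl nr : StrCsp L).
set (Q := StrCspOb kl kr : StrCsp L).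
set (P1 := @StrCspHom _ _ L Q E ql1 p1 qr1 el1 er1 : hom Q E).
set (P2 := @StrCspHom _ _ L Q S ql2 p2 qr2 el2 er2 : hom Q S).
set (EV := @StrCspHom _ _ L Q T evl ev evr el3 er3 : hom Q T).
assert (hQ : is_product P1 P2) by now apply strcsp_product.
exists E, Q, P1, P2, EV.
apply exponential_intro; [exact hQ|].
intros Z.
destruct (strcsp_product_exists limA limX Z S h1A h1X)
  as (W & W1 & W2 & hf & hg & hh).
exists W, W1, W2. split; [now apply strcsp_product|]. split.
- intros F.
  (* The apex transpose comes first; the transposes at the feet are then chosen compatible with
     it. *)
  destruct (exponential_arrow (sc_g F) he hg) as [g cg].
  destruct (xl _ _ _ _ _ _ _ _ _ _ _ _ _ hf (sc_comml W1) (sc_comml W2)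
    (sc_comml F) cg) as [f [sf cf]].
  destruct (xr _ _ _ _ _ _ _ _ _ _ _ _ _ hh (sc_commr W1) (sc_commr W2)
    (sc_commr F) cg) as [h [sh ch]].
  set (G := @StrCspHom _ _ L Z E f g h sf sh : hom Z E).
  exists G.
  destruct (product_arrow hQ (G \o W1) W2) as [K [K1 K2]].
  exists K. split; [exact K1|]. split; [exact K2|].
  apply strcsp_hom_eq.
  + exact (curries_eval hql cf (f_equal (@sc_f _ _ _ _ _) K1)
      (f_equal (@sc_f _ _ _ _ _) K2)).
  + exact (curries_eval hp cg (f_equal (@sc_g _ _ _ _ _) K1)
      (f_equal (@sc_g _ _ _ _ _) K2)).
  + exact (curries_eval hqr ch (f_equal (@sc_h _ _ _ _ _) K1)
      (f_equal (@sc_h _ _ _ _ _) K2)).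
- intros F G G' (K & K1 & K2 & K3) (K' & K1' & K2' & K3').
  (* Uniqueness at a foot presupposes a common apex arrow, so the apex components are compared
     first. *)
  assert (eg : sc_g G = sc_g G').
  { apply (exponential_eq (f := sc_g F) he hg).
    - exists (sc_g K). split; [exact (f_equal (@sc_g _ _ _ _ _) K1)|].
      split; [exact (f_equal (@sc_g _ _ _ _ _) K2)
        | exact (f_equal (@sc_g _ _ _ _ _) K3)].
    - exists (sc_g K'). split; [exact (f_equal (@sc_g _ _ _ _ _) K1')|].
      split; [exact (f_equal (@sc_g _ _ _ _ _) K2')
        | exact (f_equal (@sc_g _ _ _ _ _) K3')]. }
  apply strcsp_hom_eq; [| exact eg |].
  + apply (ul _ _ _ _ _ (sc_legl Z) (sc_g G) (sc_f F) _ _ hf (sc_comml G)).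
    * rewrite eg. exact (sc_comml G').
    * exists (sc_f K). split; [exact (f_equal (@sc_f _ _ _ _ _) K1)|].
      split; [exact (f_equal (@sc_f _ _ _ _ _) K2)
        | exact (f_equal (@sc_f _ _ _ _ _) K3)].
    * exists (sc_f K'). split; [exact (f_equal (@sc_f _ _ _ _ _) K1')|].
      split; [exact (f_equal (@sc_f _ _ _ _ _) K2')
        | exact (f_equal (@sc_f _ _ _ _ _) K3')].
  + apply (ur _ _ _ _ _ (sc_legr Z) (sc_g G) (sc_h F) _ _ hh (sc_commr G)).
    * rewrite eg. exact (sc_commr G').
    * exists (sc_h K). split; [exact (f_equal (@sc_h _ _ _ _ _) K1)|].
      split; [exact (f_equal (@sc_h _ _ _ _ _) K2)
        | exact (f_equal (@sc_h _ _ _ _ _) K3)].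
    * exists (sc_h K'). split; [exact (f_equal (@sc_h _ _ _ _ _) K1')|].
      split; [exact (f_equal (@sc_h _ _ _ _ _) K2')
        | exact (f_equal (@sc_h _ _ _ _ _) K3')].
Qed.

Lemma strcsp_subobject_classifier : has_subobject_classifier (StrCsp L).
Proof.
pose proof hA as [limA [_ (oneA & omA & trA & h1A & _)]].
pose proof hX as [limX [_ (oneX & omX & trX & hOX)]].
pose proof (proj1 hOX) as h1X.
destruct (comma_classifier adj hA h1A hOX) as (O & n & tr & etr & hex & huq).
destruct (terminal_arrow (L oneA) h1X) as [t _].
set (One := StrCspOb t t : StrCsp L).
set (Omega := StrCspOb n n : StrCsp L).
pose proof (strcsp_terminal (L := L) t t h1A h1X : is_terminal One) as hOne.
exists One, Omega,
  (@StrCspHom _ _ L One Omega tr trX tr (etr t) (etr t) : hom One Omega).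
split; [exact hOne|].
intros U S m hm.
destruct (strcsp_monic_components limA limX hm) as (mf & mg & mh).
(* The apex part of the mono is classified in [X]; each foot is then classified over that [chi]. *)
destruct (proj2 hOX _ _ _ mg) as [chi [[s hs] hu]].
destruct (hex _ _ _ _ _ _ _ _ _ _ hs mf (sc_comml m)) as [f [ef hf]].
destruct (hex _ _ _ _ _ _ _ _ _ _ hs mh (sc_commr m)) as [h [eh hh]].
exists (@StrCspHom _ _ L S Omega f chi h ef eh : hom S Omega). split.
- destruct (terminal_arrow U hOne) as [T _]. exists T.
  apply strcsp_pullback; [apply hf | | apply hh].
  rewrite (terminal_eq (sc_g T) s h1X). exact hs.
- intros Chi [T hT].
  apply (strcsp_pullback_components limA limX) in hT.
  destruct hT as (hTf & hTg & hTh).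
  (* Once the apex components agree, both candidates at a foot lie over the same [chi], as [huq]
     requires. *)
  assert (eg : chi = sc_g Chi) by exact (hu _ (ex_intro _ _ hTg)).
  apply strcsp_hom_eq; simpl; [| exact eg |].
  + apply (huq _ _ _ (sc_legl S) chi (sc_f m) (sc_f T) (sc_f T));
      [exact ef | rewrite eg; exact (sc_comml Chi) | apply hf | exact hTf].
  + apply (huq _ _ _ (sc_legr S) chi (sc_h m) (sc_h T) (sc_h T));
      [exact eh | rewrite eg; exact (sc_commr Chi) | apply hh | exact hTh].
Qed.

End StructuredCospanTopos.

Theorem theorem8 (A X : category) (L : functor A X) (R : functor X A)
    (adj : adjunction L R) (hA : is_topos A) (hX : is_topos X) :
  is_topos (StrCsp L).
Proof.
split; [exact (strcsp_finite_limits (proj1 hA) (proj1 hX))|].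
split; [exact (strcsp_exponentials adj hA hX)
  | exact (strcsp_subobject_classifier adj hA hX)].
Qed.
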